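(* Let $\gamma_D$ and $\gamma_E$ be independent nonnegative random variables, where for $i\in\{D,E\}$ the variable $\gamma_i$ is the instantaneous SNR of a fluctuating two-ray (FTR) fading channel with parameters $m_i>0$, $K_i\ge 0$, $\Delta_i\in[0,1]$, $\sigma_i^2>0$, i.e. $\gamma_i$ has the density $f_i$ given in the context, with coefficients $d_{j_i}$ as defined there. Let $C_s(\gamma_D,\gamma_E)=\max\{\ln(1+\gamma_D)-\ln(1+\gamma_E),0\}$ and $$\rho=\frac{\sigma_D^2(K_D+1)}{\sigma_E^2(K_E+1)},\qquad \eta=\frac{K_E+1}{K_D+1}.$$ Then the probability of strictly positive secrecy capacity $SPSC=P\{C_s(\gamma_D,\gamma_E)>0\}=P\{\gamma_D>\gamma_E\}$ equals $$ \begin{aligned} SPSC={}&1-\frac{m_D^{m_D}m_E^{m_E}}{\Gamma(m_D)\Gamma(m_E)}\sum_{j_D=0}^\infty\sum_{j_E=0}^\infty\frac{K_D^{j_D}d_{j_D}K_E^{j_E}d_{j_E}}{j_D!\,j_E!}\\ &\times\frac{(\rho\eta)^{j_E}}{(1+\rho\eta)^{j_D+j_E+1}}\sum_{k=0}^{j_E}\Big(\frac{1}{\rho\eta}\Big)^k\frac{(j_D+j_E+1)!}{(j_D+1+k)!\,(j_E-k)!}. \end{aligned} $$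
   Context: For $i\in\{D,E\}$ ($D$: main channel to the legitimate receiver; $E$: eavesdropper channel), the FTR fading SNR $\gamma_i$ has probability density on $(0,\infty)$ $$f_i(\gamma)=\frac{m_i^{m_i}}{\Gamma(m_i)}\sum_{j_i=0}^\infty \frac{K_i^{j_i}d_{j_i}}{j_i!\,j_i!}\,\frac{\gamma^{j_i}}{(2\sigma_i^2)^{j_i+1}}\exp\Big(-\frac{\gamma}{2\sigma_i^2}\Big),$$ and cumulative distribution function $$F_i(\gamma)=\frac{m_i^{m_i}}{\Gamma(m_i)}\sum_{j_i=0}^\infty \frac{K_i^{j_i}d_{j_i}}{j_i!\,j_i!}\,\gamma\Big(j_i+1,\frac{\gamma}{2\sigma_i^2}\Big),$$ where $\gamma(a,x)=\int_0^x t^{a-1}e^{-t}\,dt$ is the lower incomplete gamma function. The coefficients $d_{j_i}$ depend on $(m_i,K_i,\Delta_i)$ and the index $j_i$ (so $d_{j_D}$ uses the parameters of channel $D$ and $d_{j_E}$ those of channel $E$): $$d_{j_i}=\frac{\Gamma(j_i+m_i)}{\pi}\int_0^{\pi}\frac{(1+\Delta_i\cos\theta)^{j_i}}{(m_i+K_i+K_i\Delta_i\cos\theta)^{j_i+m_i}}\,d\theta .$$ The quantity $\rho$ is the ratio $\bar\gamma_D/\bar\gamma_E$ of the average SNRs, with identical $E_b/N_0$ and unit-normalized propagation distances for both channels. The natural logarithm is used, and the convention $0^0=1$ is used. *)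

(* Defs.v *)
From HB Require Import structures.
From mathcomp Require Import all_boot all_order all_algebra.
From mathcomp Require Import all_classical all_reals all_analysis.

Set Implicit Arguments.
Unset Strict Implicit.
Unset Printing Implicit Defensive.

Import Order.TTheory GRing.Theory Num.Theory.
Import numFieldNormedType.Exports.

Local Open Scope classical_set_scope.
Local Open Scope ring_scope.

(* Euler's Gamma function, meaningful for a > 0. *)
Definition Gamma (R : realType) (a : R) : R :=
  \int[@lebesgue_measure R]_(t in `]0, +oo[) (t `^ (a - 1) * expR (- t)).

(* In (1 + Delta cos theta)^j the exponent is a natural number and [x ^+ 0 = 1]
   also for x = 0; the denominator has a real exponent and, for m > 0, K >= 0
   and 0 <= Delta <= 1, a positive base. *)
Definition ftr_coef (R : realType) (m K Delta : R) (j : nat) : R :=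
  Gamma (j%:R + m) / pi *
  \int[@lebesgue_measure R]_(theta in `[0, pi])
    ((1 + Delta * cos theta) ^+ j /
     (m + K + K * Delta * cos theta) `^ (j%:R + m)).

(* The series has nonnegative terms and is summed in \bar R, so that its value
   does not rest on a convergence assumption. *)
Definition ftr_pdf (R : realType) (m K Delta sigma : R) (x : R) : \bar R :=
  ((m `^ m / Gamma m)%:E *
   \sum_(j <oo) (K ^+ j * ftr_coef m K Delta j / (j`!%:R * j`!%:R) *
                 (x ^+ j / (2 * sigma ^+ 2) ^+ j.+1) *
                 expR (- (x / (2 * sigma ^+ 2))))%:E)%E.

(* The law of X has density [ftr_pdf] on (0, +oo). *)
Definition ftr_fading d (T : measurableType d) (R : realType)
    (P : probability T R) (m K Delta sigma : R) (X : {RV P >-> R}) : Prop :=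
  forall A : set R, measurable A ->
    distribution P X A =
    (\int[@lebesgue_measure R]_(x in A `&` `]0%R, +oo[)
       ftr_pdf m K Delta sigma x)%E.

Definition independent_RVs d (T : measurableType d) (R : realType)
    (P : probability T R) (X Y : {RV P >-> R}) : Prop :=
  forall A B : set R, measurable A -> measurable B ->
    P (X @^-1` A `&` Y @^-1` B) = (P (X @^-1` A) * P (Y @^-1` B))%E.

Definition secrecy_capacity (R : realType) (x y : R) : R :=
  Num.max (ln (1 + x) - ln (1 + y)) 0.

(* Main.v *)
(* An FTR law is a mixture of Erlang laws: up to the factor [m^m / Gamma m], the
   density is the sum of K^j d_j / j!^2 times [gamma_term j (2 sigma^2)]. By
   independence, P(gammaD <= gammaE) is the integral of the tail
   P(gammaE >= x) against the law of gammaD. The tail of an Erlang law is a finite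
   sum of such terms, and the product of two terms is a multiple of a third one,
   so integrating term by term (everything is nonnegative) leaves, for each
   (jD, jE), the probability that a Poisson process of rate 1/a makes jD + 1 jumps
   before one of rate 1/b makes jE + 1 jumps, where a / b = rho * eta. It comes
   out as a negative binomial sum, which is rewritten as the binomial tail of the
   statement. Working with tails of gammaE instead of the distribution function
   of gammaD avoids any subtraction of infinite series. *)
From HB Require Import structures.
Require Import Defs.
From mathcomp Require Import all_boot all_order all_algebra.
From mathcomp Require Import all_classical all_reals all_analysis.
From mathcomp Require Import measurable_realfun.
From mathcomp Require Import ring.

Set Implicit Arguments.
Unset Strict Implicit.
Unset Printing Implicit Defensive.

Import Order.TTheory GRing.Theory Num.Theory.
Import numFieldNormedType.Exports.

Local Open Scope classical_set_scope.
Local Open Scope ring_scope.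

(** * Two forms of the negative binomial tail *)

(* For independent trials with success probability [p], both sides are the
   probability of [j.+1] successes before [k.+1] failures: on the left by the
   number [i] of failures preceding the last of them, on the right by the number
   [j + 1 + l] of successes among the first [j + k + 1] trials. *)
Lemma negative_binomial_tail (R : comNzRingType) (p q : R) (j k : nat) :
  p + q = 1 ->
  \sum_(0 <= i < k.+1) 'C(j + i, i)%:R * p ^+ j.+1 * q ^+ i =
  \sum_(0 <= l < k.+1)
    'C(j + k + 1, j + 1 + l)%:R * p ^+ (j + 1 + l) * q ^+ (k - l).
Proof.
move=> pq1; elim: k => [|k IH].
  by rewrite !big_nat1 !addn0 bin0 binn expr0 addn1.
pose n := (j + k + 1)%N.
(* [t] is the summand at [k]; Pascal's rule splits the summand at [k.+1], of index [l.+1], into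
   [u l + p * t l]. *)
pose t l := 'C(n, j + 1 + l)%:R * p ^+ (j + 1 + l) * q ^+ (k - l) : R.
pose u l := 'C(n, (j + 1 + l).+1)%:R * p ^+ (j + 1 + l).+1 * q ^+ (k - l) : R.
rewrite big_nat_recr//= IH [RHS]big_nat_recl//= -/n.
rewrite -[X in X + _ = _]/(\sum_(0 <= l < k.+1) t l).
under [in RHS]eq_bigr => l _.
  rewrite subSS [(j + 1 + l.+1)%N]addnS [(j + k.+1 + 1)%N](_ : _ = n.+1);
    last by rewrite /n !addn1 addnS.
  rewrite binS (_ : _ * _ = u l + p * t l); first over.
  rewrite natrD /u /t !exprS 2!mulrDl; congr (_ + _).
  by rewrite mulrCA -!mulrA.
rewrite big_split/= -mulr_sumr -/(t _).
(* [u l = q * t l.+1] for [l < k], and [u k] vanishes because its lower binomial index exceeds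
   [n]. *)
have -> : \sum_(0 <= l < k.+1) u l = q * \sum_(1 <= l < k.+1) t l.
  rewrite big_nat_recr//= {2}/u bin_small ?mul0r ?addr0; last first.
    by rewrite /n !ltnS addnAC.
  rewrite big_add1/= mulr_sumr; apply: eq_big_nat => l /= lk.
  by rewrite /u /t [(j + 1 + l.+1)%N]addnS -[in LHS](subnSK lk) (exprS q) mulrCA.
have -> : 'C(j + k.+1, k.+1) = 'C(n, j).
  by rewrite -(bin_sub (leq_addl j k.+1)) addnK /n addnS addn1.
rewrite [(j + k.+1 + 1)%N](_ : _ = n.+1); last by rewrite /n !addn1 addnS.
rewrite addn0 subn0 addn1 binS natrD.
have S0 : \sum_(0 <= l < k.+1) t l = t 0 + \sum_(1 <= l < k.+1) t l.
  by rewrite big_ltn.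
set S := \sum_(0 <= l < k.+1) t l in S0 *.
have -> : \sum_(1 <= l < k.+1) t l = S - t 0 by rewrite S0 addrC addKr.
have -> : t 0 = 'C(n, j.+1)%:R * p ^+ j.+1 * q ^+ k.
  by rewrite /t addn0 subn0 addn1.
(* Since [p + q = 1], the sums combine to [S - q * t 0], and [q * t 0] cancels one Pascal part of
   the term at [l = 0]. *)
have -> : p * S = S - q * S by rewrite -[X in X - _]mul1r -pq1 mulrDl addrK.
by rewrite (exprS q); ring.
Qed.

(** The odds of failure are [a / b], so every term of the binomial tail carries the same power of
    [1 + a / b]; the remaining [(a / b) ^+ (k - l)] splits into [(a / b) ^+ k] and an inverse
    power. *)
Lemma negative_binomial_tail_odds (R : realFieldType) (a b : R) (j k : nat) :
  0 < a -> 0 < b ->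
  \sum_(0 <= i < k.+1)
    'C(j + i, i)%:R * (b / (a + b)) ^+ j.+1 * (a / (a + b)) ^+ i =
  (a / b) ^+ k / (1 + a / b) ^+ (j + k + 1) *
  \sum_(0 <= l < k.+1) (1 / (a / b)) ^+ l *
    ((j + k + 1)`!%:R / ((j + 1 + l)`!%:R * (k - l)`!%:R)).
Proof.
move=> a0 b0; have ab0 : 0 < a + b by rewrite addr_gt0.
have bn0 := lt0r_neq0 b0; have abn0 := lt0r_neq0 ab0.
rewrite negative_binomial_tail; last first.
  by rewrite -mulrDl addrC divff// lt0r_neq0.
rewrite mulr_sumr; apply: eq_big_nat => l; rewrite ltnS => /andP[_ lk].
have nE : (j + k + 1 = (j + 1 + l) + (k - l))%N.
  by rewrite -[RHS]addnA subnKC// addnAC.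
have -> : b / (a + b) = (1 + a / b)^-1.
  by field; rewrite [b + a]addrC bn0 abn0.
have -> : a / (a + b) = (a / b) * (1 + a / b)^-1.
  by field; rewrite [b + a]addrC bn0 abn0.
have r0 : a / b != 0 by rewrite lt0r_neq0// divr_gt0.
have rl : (1 / (a / b)) ^+ l = (a / b) ^+ (k - l) / (a / b) ^+ k.
  by rewrite -{2}(subnK lk) exprD div1r exprVn invfM mulrA divff ?mul1r ?expf_neq0.
have binE : 'C(j + k + 1, j + 1 + l)%:R =
    (j + k + 1)`!%:R / ((j + 1 + l)`!%:R * (k - l)`!%:R) :> R.
  have le : (j + 1 + l <= j + k + 1)%N by rewrite nE leq_addr.
  by rewrite -(bin_fact le) nE addKn !natrM mulfK.
have c0 : 1 + a / b != 0 by rewrite lt0r_neq0// addr_gt0 ?divr_gt0.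
rewrite binE rl exprMn !exprVn.
have -> : (1 + a / b) ^+ (j + k + 1) =
    (1 + a / b) ^+ (j + 1 + l) * (1 + a / b) ^+ (k - l) by rewrite nE exprD.
have := expf_neq0 k r0; have := expf_neq0 (k - l) c0.
have := expf_neq0 (j + 1 + l) c0.
move: (_ / (_ * _)) (_ ^+ (j + 1 + l)) (_ ^+ (k - l)) (_ ^+ (k - l)) (_ ^+ k).
move=> B cu xv cv xk *; field.
by do ![apply/andP; split].
Qed.

(** * Erlang densities and their tails *)

Section gamma_term.
Context {R : realType}.
Local Notation mu := (@lebesgue_measure R).

(* [n`!] times the density of the Erlang law of shape [n.+1] and scale [a]. *)
Definition gamma_term (n : nat) (a x : R) : R :=
  x ^+ n / a ^+ n.+1 * expR (- (x / a)).

(** For [0 < a] and [0 <= x] this is n! times the probability that a Poisson variable of mean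
    [x / a] is at most [n]: the upper incomplete gamma function in closed form. *)
Definition gamma_tail (n : nat) (a x : R) : R :=
  \sum_(0 <= i < n.+1) n`!%:R / i`!%:R * a * gamma_term i a x.

Lemma gamma_term_ge0 n a x : 0 < a -> 0 <= x -> 0 <= gamma_term n a x.
Proof.
by move=> a0 x0; rewrite mulr_ge0 ?expR_ge0// divr_ge0// exprn_ge0// ltW.
Qed.

Lemma gamma_tail_ge0 n a x : 0 < a -> 0 <= x -> 0 <= gamma_tail n a x.
Proof.
move=> a0 x0; apply: sumr_ge0 => i _.
by rewrite mulr_ge0 ?gamma_term_ge0// mulr_ge0 ?(ltW a0)// divr_ge0.
Qed.

Lemma gamma_tail0 a x : gamma_tail 0 a x = a * gamma_term 0 a x.
Proof. by rewrite /gamma_tail big_nat1 fact0 divr1 mul1r. Qed.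

Lemma gamma_tailS n a x : gamma_tail n.+1 a x =
  n.+1%:R * gamma_tail n a x + a * gamma_term n.+1 a x.
Proof.
rewrite /gamma_tail big_nat_recr//= divff ?mul1r; last first.
  by rewrite pnatr_eq0 -lt0n fact_gt0.
congr (_ + _); rewrite mulr_sumr; apply: eq_bigr => i _.
by rewrite factS natrM !mulrA.
Qed.

Lemma gamma_tail_at0 n a : 0 < a -> gamma_tail n a 0 = n`!%:R.
Proof.
move=> a0; rewrite /gamma_tail big_nat_recl//= big1 ?addr0 => [|i _].
  by rewrite /gamma_term expr0 expr1 mul0r oppr0 expR0 fact0; field; rewrite gt_eqF.
by rewrite /gamma_term expr0n/= !mul0r mulr0.
Qed.

(** At [n = 0] the truncated exponent [n.-1] is harmless, as the factor [n%:R] vanishes. *)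
Lemma is_derive_gamma_term n (a x : R) :
  is_derive x 1 (gamma_term n a)
    ((n%:R * x ^+ n.-1 / a ^+ n.+1) * expR (- (x / a)) - gamma_term n a x / a).
Proof.
have dX : is_derive x 1 (fun y : R => y ^+ n) (n%:R * x ^+ n.-1).
  have := is_deriveX n (is_derive_id x (1 : R)).
  by rewrite exprfctE /GRing.scale/= mulr1.
rewrite [X in is_derive _ _ X _](_ : _ =
    ((fun y => y ^+ n) * cst (a ^+ n.+1)^-1) * (expR \o (- (id * cst a^-1)))).
  apply: is_derive_eq.
  rewrite -[LHS]/((x ^+ n * (a ^+ n.+1)^-1) * (expR (- (x * a^-1)) *
      - (x * 0 + a^-1 * 1)) + expR (- (x * a^-1)) *
      (x ^+ n * 0 + (a ^+ n.+1)^-1 * (n%:R * x ^+ n.-1))).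
  by rewrite /gamma_term; ring.
by apply/funext => y; rewrite /gamma_term.
Qed.

(** The sum telescopes: the derivative of [a * gamma_term n.+1 a] contains
    [n.+1%:R * gamma_term n a], which cancels the contribution of the induction hypothesis. *)
Lemma is_derive_gamma_tail n (a x : R) : 0 < a ->
  is_derive x 1 (gamma_tail n a) (- gamma_term n a x).
Proof.
move=> a0; have an0 : a != 0 by rewrite gt_eqF.
elim: n => [|n IH].
  rewrite (_ : gamma_tail 0 a = cst a * gamma_term 0 a); last first.
    by apply/funext => y; rewrite gamma_tail0.
  have h := is_derive_gamma_term 0 a x.
  by apply: is_derive_eq; rewrite /GRing.scale/= ?fctE /gamma_term; field.
rewrite (_ : gamma_tail n.+1 a =
    cst n.+1%:R * gamma_tail n a + cst a * gamma_term n.+1 a); last first.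
  by apply/funext => y; rewrite gamma_tailS.
have h := is_derive_gamma_term n.+1 a x.
apply: is_derive_eq; rewrite /GRing.scale/= ?fctE /gamma_term !exprS; field.
by rewrite an0 expf_neq0.
Qed.

Lemma continuous_gamma_term n (a : R) : continuous (gamma_term n a).
Proof.
move=> x; apply: differentiable_continuous; apply/derivable1_diffP.
by case: (is_derive_gamma_term n a x).
Qed.

Lemma measurable_gamma_term n (a : R) D : measurable_fun D (gamma_term n a).
Proof.
apply: measurable_funTS; apply: continuous_measurable_fun.
exact: continuous_gamma_term.
Qed.

Lemma measurable_gamma_tail n (a : R) D : measurable_fun D (gamma_tail n a).
Proof.
apply: measurable_sum => i; apply: measurable_funM => //.
exact: measurable_gamma_term.
Qed.

Lemma cvg_gamma_term n (a : R) : 0 < a -> gamma_term n a x @[x --> +oo] --> 0.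
Proof.
move=> a0; apply/cvgrPdist_le => /= e e0; near=> x.
have x0 : 0 < x by near: x; apply: nbhs_pinfty_gt; exact: num_real.
have u0 : 0 < x / a by rewrite divr_gt0.
rewrite sub0r normrN ger0_norm ?gamma_term_ge0 ?(ltW x0)//.
(* With u = x / a the term equals u^(n+1) e^(-u) / x, and e^u is at least u^(n+1) / (n+1)!. *)
apply: (@le_trans _ _ (n.+1`!%:R / x)); last first.
  by rewrite ler_pdivrMr// mulrC -ler_pdivrMr.
have := expR_ge1Dxn n (ltW u0).
move=> /(le_trans (ler_wpDl ler01 (lexx _))).
rewrite ler_pdivrMr ?ltr0n ?fact_gt0// => h.
rewrite ler_pdivlMr// /gamma_term expRN mulrAC ler_pdivrMr ?expR_gt0// [leRHS]mulrC.
by apply: le_trans h; rewrite expr_div_n mulrAC -exprSr.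
Unshelve. all: by end_near. Qed.

Lemma cvg_gamma_tail n (a : R) : 0 < a -> gamma_tail n a x @[x --> +oo] --> 0.
Proof.
move=> a0; elim: n => [|n IH].
  rewrite (_ : gamma_tail 0 a = fun x => a * gamma_term 0 a x); last first.
    by apply/funext => y; rewrite gamma_tail0.
  by rewrite -(mulr0 a); apply: cvgM; [exact: cvg_cst|exact: cvg_gamma_term].
rewrite (_ : gamma_tail n.+1 a =
    fun x => n.+1%:R * gamma_tail n a x + a * gamma_term n.+1 a x); last first.
  by apply/funext => y; rewrite gamma_tailS.
have -> : 0 = n.+1%:R * 0 + a * 0 :> R by rewrite !mulr0 addr0.
apply: cvgD; apply: cvgM; [exact: cvg_cst|exact: IH|exact: cvg_cst|].
exact: cvg_gamma_term.
Qed.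

Lemma integral_gamma_term n (a x : R) : 0 < a -> 0 <= x ->
  (\int[mu]_(t in `[x, +oo[) (gamma_term n a t)%:E = (gamma_tail n a x)%:E)%E.
Proof.
move=> a0 x0; have h t := is_derive_gamma_tail n t a0.
rewrite (@ge0_continuous_FTC2y _ (gamma_term n a) (\- gamma_tail n a) x 0).
- by rewrite sub0e EFinN oppeK.
- by move=> t xt; apply: gamma_term_ge0 => //; exact: le_trans xt.
- by apply: continuous_subspaceT; exact: continuous_gamma_term.
- by rewrite -oppr0; apply: cvgN; exact: cvg_gamma_tail.
- by move=> t _; apply: derivableN; case: (h t).
- apply: cvg_at_right_filter; apply: cvgN.
  apply: differentiable_continuous; apply/derivable1_diffP.
  by case: (h x).
- move=> t _; rewrite derive1E deriveN; last by case: (h t).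
  by rewrite derive_val opprK.
Qed.

(** The rates [1 / a] and [1 / b] add up to that of the scale [a * b / (a + b)]; [b / (a + b)] and
    [a / (a + b)] are the probabilities that the next jump comes from the process of rate [1 / a] or
    [1 / b]. *)
Lemma gamma_termM i j (a b x : R) : 0 < a -> 0 < b ->
  gamma_term j a x * gamma_term i b x =
  (b / (a + b)) ^+ j.+1 * (a / (a + b)) ^+ i / b *
    gamma_term (j + i) (a * b / (a + b)) x.
Proof.
move=> a0 b0; have ab0 : 0 < a + b by rewrite addr_gt0.
rewrite /gamma_term [LHS]mulrACA -expRD.
have -> : - (x / a) + - (x / b) = - (x / (a * b / (a + b))).
  by field; rewrite !gt_eqF.
rewrite [RHS]mulrA; congr (_ * _).
rewrite !expr_div_n !exprMn !exprS !exprD.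
have := expf_neq0 i (lt0r_neq0 a0); have := expf_neq0 j (lt0r_neq0 a0).
have := expf_neq0 i (lt0r_neq0 b0); have := expf_neq0 j (lt0r_neq0 b0).
have := expf_neq0 i (lt0r_neq0 ab0); have := expf_neq0 j (lt0r_neq0 ab0).
move: (a ^+ i) (a ^+ j) (b ^+ i) (b ^+ j) ((a + b) ^+ i) ((a + b) ^+ j).
move=> ai aj bi bj ci cj *; field.
by rewrite (lt0r_neq0 a0) (lt0r_neq0 b0) (lt0r_neq0 ab0); do ![apply/andP; split].
Qed.

Lemma integral_gamma_term_tail j k (a b : R) : 0 < a -> 0 < b ->
  (\int[mu]_(x in `]0%R, +oo[) (gamma_term j a x * gamma_tail k b x)%:E =
   (j`!%:R * k`!%:R * \sum_(0 <= i < k.+1)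
     'C(j + i, i)%:R * (b / (a + b)) ^+ j.+1 * (a / (a + b)) ^+ i)%:E)%E.
Proof.
move=> a0 b0; set c := a * b / (a + b).
have c0 : 0 < c by rewrite divr_gt0 ?mulr_gt0 ?addr_gt0.
(* The factor [b] in the terms of [gamma_tail k b] cancels the division by [b] in [gamma_termM]. *)
pose w i : R := k`!%:R / i`!%:R * (b / (a + b)) ^+ j.+1 * (a / (a + b)) ^+ i.
have w0 i : 0 <= w i.
  by rewrite !mulr_ge0 ?exprn_ge0 ?divr_ge0 ?addr_ge0 ?invr_ge0 ?(ltW a0) ?(ltW b0).
under eq_integral => x _.
  rewrite (_ : _%:E = \sum_(0 <= i < k.+1) (w i * gamma_term (j + i) c x)%:E)%E.
    over.
  rewrite sumEFin; congr (_%:E); rewrite mulr_sumr; apply: eq_bigr => i _.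
  rewrite mulrCA gamma_termM// -/c /w.
  by rewrite mulrACA -!mulrA; congr (_ * (_ * _)); field; rewrite !gt_eqF ?addr_gt0.
rewrite ge0_integral_sum//; last 2 first.
- move=> i; apply/measurable_EFinP/measurable_funM => //.
  exact: measurable_gamma_term.
- move=> i x; rewrite /= in_itv/= andbT => x0.
  by rewrite lee_fin mulr_ge0// gamma_term_ge0// ltW.
rewrite mulr_sumr -sumEFin; apply: eq_bigr => i _.
under eq_integral do rewrite EFinM.
rewrite ge0_integralZl_EFin//; last 2 first.
- move=> x; rewrite /= in_itv/= andbT => x0.
  by rewrite lee_fin gamma_term_ge0// ltW.
- by apply/measurable_EFinP; exact: measurable_gamma_term.
rewrite integral_itv_obnd_cbnd; last first.
  by apply/measurable_EFinP; exact: measurable_gamma_term.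
rewrite integral_gamma_term// gamma_tail_at0// -EFinM; congr (_%:E).
(* The integral contributes (j+i)!, and (j+i)! / i! is ['C(j + i, i)] times j!. *)
rewrite /w -(bin_fact (leq_addl j i)) addnK !natrM.
by field; rewrite pnatr_eq0 -lt0n fact_gt0.
Qed.

End gamma_term.

(** * Integration against a measure given by a density *)

Section density.
Local Open Scope ereal_scope.
Context d (T : measurableType d) (R : realType).
Variables (nu mu : {measure set T -> \bar R}) (D : set T) (f g : T -> \bar R).
Hypothesis mD : measurable D.
Hypothesis mf : measurable_fun D f.
Hypothesis f0 : forall x, D x -> 0 <= f x.
Hypothesis nuE : forall A, measurable A -> nu A = \int[mu]_(x in A `&` D) f x.
Hypothesis mg : measurable_fun setT g.
Hypothesis g0 : forall x, 0 <= g x.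

Import HBNNSimple.

(** Monotone convergence along simple functions increasing to [g] reduces the claim to their level
    sets, where it is [nuE]. *)
Lemma ge0_integral_density : \int[nu]_x g x = \int[mu]_(x in D) (f x * g x).
Proof.
pose h := nnsfun_approx measurableT mg.
transitivity (limn (fun n => \int[nu]_x (h n x)%:E)).
  rewrite -monotone_convergence//.
  - by apply: eq_integral => y _; apply/esym/cvg_lim => //; exact: cvg_nnsfun_approx.
  - by move=> n; exact/measurable_EFinP/measurable_funP.
  - by move=> n y _; rewrite lee_fin.
  - by move=> y _ m n mn; rewrite lee_fin; exact/lefP/nd_nnsfun_approx.
have mhf n : measurable_fun D (fun x => f x * (h n x)%:E).
  apply: emeasurable_funM => //.
  exact/measurable_EFinP/measurable_funTS/measurable_funP.
transitivity (limn (fun n => \int[mu]_(x in D) (f x * (h n x)%:E))); last first.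
  rewrite -monotone_convergence//.
  - apply: eq_integral => y /[!inE] yD; apply/cvg_lim => //.
    have hg : EFin \o h ^~ y @ \oo --> g y by exact: cvg_nnsfun_approx.
    (* [f y] may be infinite, so the cases where [0 * +oo] could occur in the
       limit are treated apart. *)
    have [fy0|fy0] := eqVneq (f y) 0.
      by under eq_fun do rewrite fy0 mul0e; rewrite fy0 mul0e; exact: cvg_cst.
    have [gy0|gy0] := eqVneq (g y) 0.
      have hy0 n : (h n y)%:E = 0.
        apply/eqP; rewrite eq_le; apply/andP; split; last by rewrite lee_fin.
        by rewrite -gy0 /h nnsfun_approxE; exact: le_approx.
      by under eq_fun do rewrite hy0 mule0; rewrite gy0 mule0; exact: cvg_cst.
    apply: cvgeM => //; last exact: cvg_cst.
    by rewrite mule_defE negb_or !negb_and gy0 fy0.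
  - by move=> n y yD; rewrite mule_ge0 ?f0// lee_fin.
  - move=> y yD m n mn; rewrite lee_wpmul2l ?f0// lee_fin.
    exact/lefP/nd_nnsfun_approx.
congr (limn _); apply/funext => n.
under eq_integral do rewrite fimfunE -fsumEFin//.
rewrite ge0_integral_fsum//; last 2 first.
- by move=> y; exact/measurable_EFinP/measurable_funM.
- by move=> y x _; rewrite nnfun_muleindic_ge0.
transitivity (\sum_(r \in range (h n))
    \int[mu]_(x in D) (f x * (r * \1_(h n @^-1` [set r]) x)%:E)); last first.
  rewrite -ge0_integral_fsum//; last 2 first.
  - move=> r; apply: emeasurable_funM => //.
    exact/measurable_EFinP/measurable_funTS/measurable_funM.
  - by move=> r x xD; rewrite mule_ge0 ?f0// nnfun_muleindic_ge0.
  apply: eq_integral => x /[!inE] xD.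
  rewrite [in RHS]fimfunE -fsumEFin// ge0_mule_fsumr// => r.
  by rewrite nnfun_muleindic_ge0.
apply: eq_fsbigr => r _; rewrite integralZl_indic_nnsfun//= integral_indic//= setIT.
rewrite nuE//.
(* A negative [r] has an empty level set, so both sides vanish; a nonnegative one can be taken out
   of the integral. *)
have [r0|r0] := ltP r 0%R.
  rewrite preimage_nnfun0// set0I integral_set0 mule0.
  by rewrite integral0_eq// => x _; rewrite indic0 mulr0 mule0.
under [RHS]eq_integral => x _ do rewrite EFinM muleCA.
rewrite ge0_integralZl//; last 2 first.
- apply: emeasurable_funM => //; exact/measurable_EFinP.
- by move=> x xD; rewrite mule_ge0 ?f0// lee_fin.
congr (_ * _).
rewrite setIC integral_mkcondr; apply: eq_integral => x xD.
by rewrite patchE indicE; case: (x \in _); rewrite ?mule1 ?mule0.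
Qed.

End density.

(** * Comparison of two independent variables *)

Lemma measurable_le_pair (R : realType) :
  measurable [set z : R * R | z.1 <= z.2].
Proof. by rewrite -[X in measurable X]setTI; exact: measurable_fun_le. Qed.

Lemma xsection_le_pair (R : realType) (x : R) :
  xsection [set z : R * R | z.1 <= z.2] x = [set` `[x, +oo[].
Proof. by apply/seteqP; split => y; rewrite /xsection/= inE/= in_itv/= andbT. Qed.

(** The tail is the measure of a section of a measurable half-plane, hence measurable in [x]. *)
Lemma measurable_fun_tail (R : realType) (mu : probability R R) :
  measurable_fun setT (fun x : R => mu [set` `[x, +oo[]).
Proof.
under eq_fun do rewrite -xsection_le_pair.
exact: (measurable_fun_xsection mu (@measurable_le_pair R)).
Qed.

(** By independence the joint law agrees with the product measure on rectangles, hence everywhere;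
    the product measure of the half-plane is the integral of the measures of its sections. *)
Lemma independent_prob_le d (T : measurableType d) (R : realType)
    (P : probability T R) (X Y : {RV P >-> R}) :
  independent_RVs X Y ->
  (P [set w | (X w <= Y w)%R] =
   \int[distribution P X]_x distribution P Y [set` `[x, +oo[])%E.
Proof.
move=> XY.
have mXY : measurable_fun setT (fun w => (X w, Y w)).
  exact: measurable_fun_pair.
pose Z : {RV P >-> (R * R)%type} :=
  HB.pack (fun w => (X w, Y w)) (isMeasurableFun.Build _ _ _ _ _ mXY).
transitivity (distribution P Z [set z | (z.1 <= z.2)%R]); first by [].
rewrite -(@product_measure_unique _ _ _ _ _ (distribution P X)
  (distribution P Y) (distribution P Z) _ _ (@measurable_le_pair R)).
  by apply: eq_integral => x _; rewrite /= xsection_le_pair.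
by move=> A B mA mB; rewrite -[RHS]XY.
Qed.

(** * FTR laws as mixtures of Erlang laws *)

Section ftr_pdf.
Context {R : realType}.
Variables (m K Delta sigma : R).
Hypothesis Delta01 : 0 <= Delta <= 1.
Hypothesis K0 : 0 <= K.

Lemma Gamma_ge0 (a : R) : 0 <= Gamma a.
Proof.
by apply: Rintegral_ge0 => t _; rewrite mulr_ge0 ?powR_ge0 ?expR_ge0.
Qed.

(** [|Delta * cos t| <= 1] makes the integrand nonnegative. This sign justifies the exchanges of
    series and integrals below. *)
Lemma ftr_coef_ge0 j : 0 <= ftr_coef m K Delta j.
Proof.
have /andP[D0 D1] := Delta01.
rewrite mulr_ge0 ?divr_ge0 ?Gamma_ge0 ?pi_ge0//.
apply: Rintegral_ge0 => t _; rewrite divr_ge0 ?powR_ge0// exprn_ge0//.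
have : `|Delta * cos t| <= 1.
  rewrite normrM -[leRHS]mulr1 ler_pM//; first by rewrite ger0_norm.
  by rewrite ler_norml cos_geN1 cos_le1.
by rewrite ler_norml => /andP[+ _]; rewrite -subr_ge0 opprK addrC.
Qed.

(** One of the two factorials normalizes [gamma_term j] to an Erlang density; the other belongs to
    the mixture weight. *)
Definition ftr_weight j : R := K ^+ j * ftr_coef m K Delta j / (j`!%:R * j`!%:R).

Lemma ftr_weight_ge0 j : 0 <= ftr_weight j.
Proof.
apply: divr_ge0; last exact: mulr_ge0.
by apply: mulr_ge0; [exact: exprn_ge0|exact: ftr_coef_ge0].
Qed.

End ftr_pdf.

Lemma ftr_pdfE (R : realType) (m K Delta sigma x : R) :
  ftr_pdf m K Delta sigma x = ((m `^ m / Gamma m)%:E *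
    \sum_(j <oo) (ftr_weight m K Delta j *
      gamma_term j (2 * sigma ^+ 2) x)%:E)%E.
Proof.
by congr (_ * _)%E; apply: eq_eseriesr => j _; rewrite /gamma_term -!mulrA.
Qed.

Lemma ftr_norm_ge0 (R : realType) (m : R) : 0 <= m `^ m / Gamma m.
Proof. by rewrite divr_ge0 ?powR_ge0 ?Gamma_ge0. Qed.

Section ftr_tail.
Local Open Scope ereal_scope.
Context d (T : measurableType d) (R : realType).
Variables (P : probability T R) (X : {RV P >-> R}) (m K Delta sigma : R).
Hypothesis K0 : (0 <= K)%R.
Hypothesis Delta01 : (0 <= Delta <= 1)%R.
Hypothesis sigma0 : (0 < sigma ^+ 2)%R.
Hypothesis ftrX : ftr_fading m K Delta sigma X.
Let a : R := (2 * sigma ^+ 2)%R.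

Let a0 : (0 < a)%R. Proof. by rewrite mulr_gt0. Qed.

Let wg_ge0 j x : (0 <= x)%R -> (0 <= ftr_weight m K Delta j * gamma_term j a x)%R.
Proof. by move=> x0; rewrite mulr_ge0 ?ftr_weight_ge0 ?gamma_term_ge0. Qed.

Let mwg j D : measurable_fun D
  (fun x : R => (ftr_weight m K Delta j * gamma_term j a x)%:E).
Proof.
by apply/measurable_EFinP/measurable_funM => //; exact: measurable_gamma_term.
Qed.

Lemma ftr_pdf_ge0 x : (0 <= x)%R -> 0 <= ftr_pdf m K Delta sigma x.
Proof.
move=> x0; rewrite ftr_pdfE mule_ge0 ?lee_fin ?ftr_norm_ge0//.
by apply: nneseries_ge0 => j _ _; rewrite lee_fin wg_ge0.
Qed.

Lemma measurable_ftr_pdf :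
  measurable_fun (`]0%R, +oo[ : set R) (ftr_pdf m K Delta sigma).
Proof.
rewrite (funext (ftr_pdfE m K Delta sigma)).
apply: emeasurable_funM => //.
apply: ge0_emeasurable_sum => [j x|j _]; last exact: mwg.
by rewrite /= in_itv/= andbT => x0 _; rewrite lee_fin wg_ge0// ltW.
Qed.

Lemma ftr_tail x : (0 < x)%R ->
  distribution P X [set` `[x, +oo[] = (m `^ m / Gamma m)%:E *
    \sum_(j <oo) (ftr_weight m K Delta j * gamma_tail j a x)%:E.
Proof.
(* As [0 < x], the half-line lies inside the domain []0, +oo[] of the density. *)
move=> x0; rewrite ftrX// setIidl; last first.
  by move=> y; rewrite /= !in_itv/= !andbT; exact: lt_le_trans.
have xy (y : R) : y \in `[x, +oo[ -> (0 <= y)%R.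
  by rewrite in_itv/= andbT => /(le_trans (ltW x0)).
under eq_integral do rewrite ftr_pdfE -/a.
rewrite ge0_integralZl_EFin ?ftr_norm_ge0//; last 2 first.
- by move=> y /= /xy y0; apply: nneseries_ge0 => j _ _; rewrite lee_fin wg_ge0.
- apply: ge0_emeasurable_sum => [j y /= /xy y0 _|j _]; last exact: mwg.
  by rewrite lee_fin wg_ge0.
rewrite integral_nneseries//; last 2 first.
- by move=> j; exact: mwg.
- by move=> j y /= /xy y0; rewrite lee_fin wg_ge0.
congr (_ * _); apply: eq_eseriesr => j _.
under eq_integral do rewrite EFinM.
rewrite ge0_integralZl_EFin ?ftr_weight_ge0//; last 2 first.
- by move=> y /= /xy y0; rewrite lee_fin gamma_term_ge0.
- by apply/measurable_EFinP; exact: measurable_gamma_term.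
by rewrite integral_gamma_term// ltW.
Qed.

Lemma ge0_integral_ftr (g : R -> \bar R) :
  measurable_fun setT g -> (forall x, 0 <= g x) ->
  (forall x, g x \is a fin_num) ->
  \int[distribution P X]_x g x = (m `^ m / Gamma m)%:E *
    \sum_(j <oo) \int[@lebesgue_measure R]_(x in `]0%R, +oo[)
      ((ftr_weight m K Delta j * gamma_term j a x)%:E * g x).
Proof.
move=> mg g0 gfin.
(* [lebesgue_measure] lives on [measurableTypeR R], whose display differs from
   that of [R], the codomain of [X]. *)
have mX : measurable_fun setT (X : T -> measurableTypeR R).
  exact: (measurable_funP X).
pose X' : {RV P >-> measurableTypeR R} :=
  HB.pack (X : T -> measurableTypeR R) (isMeasurableFun.Build _ _ _ _ _ mX).
have mg' : measurable_fun [set: measurableTypeR R] g by exact: mg.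
rewrite ge0_integral_distribution//.
transitivity (\int[distribution P X']_x g x).
  by rewrite ge0_integral_distribution.
rewrite (@ge0_integral_density _ (measurableTypeR R) R (distribution P X')
  lebesgue_measure `]0%R, +oo[ (ftr_pdf m K Delta sigma))//; last 2 first.
- exact: measurable_ftr_pdf.
- by move=> x; rewrite /= in_itv/= andbT => x0; rewrite ftr_pdf_ge0// ltW.
have wgg_ge0 j (x : R) : x \in `]0%R, +oo[ ->
    0 <= (ftr_weight m K Delta j * gamma_term j a x)%:E * g x.
  by rewrite in_itv/= andbT => x0; rewrite mule_ge0// lee_fin wg_ge0// ltW.
have mwgg j : measurable_fun (`]0%R, +oo[ : set R)
    (fun x => (ftr_weight m K Delta j * gamma_term j a x)%:E * g x).
  apply: emeasurable_funM; first exact: mwg.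
  exact: measurable_funTS.
rewrite -integral_nneseries//.
rewrite -ge0_integralZl_EFin ?ftr_norm_ge0//; last 2 first.
- by move=> x /= x0; apply: nneseries_ge0 => j _ _; exact: wgg_ge0.
- by apply: ge0_emeasurable_sum => [j x /= x0 _|j _]; [exact: wgg_ge0|exact: mwgg].
apply: eq_integral => x; rewrite inE/= in_itv/= andbT => x0.
rewrite ftr_pdfE -muleA; congr (_ * _).
(* Finiteness of [g x] lets it enter the series as a real scalar. *)
rewrite -(fineK (gfin x)) muleC -nneseriesZl; last first.
  by move=> j _; rewrite lee_fin wg_ge0// ltW.
by apply: eq_eseriesr => j _; rewrite muleC.
Qed.

End ftr_tail.

(** * The probability that one FTR variable is at most another *)

Section ftr_race.
Local Open Scope ereal_scope.
Context d (T : measurableType d) (R : realType).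
Variables (P : probability T R) (X Y : {RV P >-> R}).
Variables (mX KX DX sX mY KY DY sY : R).
Hypotheses (KX0 : (0 <= KX)%R) (KY0 : (0 <= KY)%R).
Hypotheses (DX01 : (0 <= DX <= 1)%R) (DY01 : (0 <= DY <= 1)%R).
Hypotheses (sX0 : (0 < sX ^+ 2)%R) (sY0 : (0 < sY ^+ 2)%R).
Hypothesis ftrX : ftr_fading mX KX DX sX X.
Hypothesis ftrY : ftr_fading mY KY DY sY Y.
Hypothesis XY : independent_RVs X Y.
Let a : R := (2 * sX ^+ 2)%R.
Let b : R := (2 * sY ^+ 2)%R.

Lemma ftr_prob_le : P [set w | (X w <= Y w)%R] =
  (mX `^ mX / Gamma mX * (mY `^ mY / Gamma mY))%:E *
  \sum_(j <oo) \sum_(k <oo)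
    (ftr_weight mX KX DX j * ftr_weight mY KY DY k *
     (j`!%:R * k`!%:R * \sum_(0 <= i < k.+1)
       'C(j + i, i)%:R * (b / (a + b)) ^+ j.+1 * (a / (a + b)) ^+ i))%:E.
Proof.
have a0 : (0 < a)%R by rewrite mulr_gt0.
have b0 : (0 < b)%R by rewrite mulr_gt0.
rewrite independent_prob_le//.
rewrite (ge0_integral_ftr KX0 DX01 sX0 ftrX)//; last 2 first.
- exact: measurable_fun_tail.
- by move=> x; rewrite fin_num_measure.
rewrite (EFinM (mX `^ mX / Gamma mX)) -muleA; congr (_ * _).
have h_ge0 j k (x : R) : (0 < x)%R -> 0 <= (ftr_weight mX KX DX j *
    ftr_weight mY KY DY k * (gamma_term j a x * gamma_tail k b x))%:E.
  move=> x0; rewrite lee_fin; apply: mulr_ge0.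
    by rewrite mulr_ge0 ?ftr_weight_ge0.
  by rewrite mulr_ge0 ?gamma_term_ge0 ?gamma_tail_ge0 ?(ltW x0).
have mh j k : measurable_fun (`]0%R, +oo[ : set R)
    (fun x => (gamma_term j a x * gamma_tail k b x)%:E).
  apply/measurable_EFinP/measurable_funM; first exact: measurable_gamma_term.
  exact: measurable_gamma_tail.
have mwh j k : measurable_fun (`]0%R, +oo[ : set R) (fun x => (ftr_weight mX KX DX j *
    ftr_weight mY KY DY k * (gamma_term j a x * gamma_tail k b x))%:E).
  apply/measurable_EFinP/measurable_funM => //.
  by apply/measurable_EFinP; exact: mh.
rewrite -nneseriesZl; last first.
  move=> j _; apply: nneseries_ge0 => k _ _; rewrite lee_fin.
  apply: mulr_ge0; first by rewrite mulr_ge0 ?ftr_weight_ge0.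
  apply: mulr_ge0; first exact: mulr_ge0.
  apply: sumr_ge0 => i _.
  by rewrite !mulr_ge0 ?exprn_ge0 ?divr_ge0 ?addr_ge0 ?(ltW a0) ?(ltW b0).
apply: eq_eseriesr => j _.
(* The [j]-th term of the density of [X] is absorbed into the tail series of [Y], so that each
   integrand becomes a constant times [gamma_term j a x * gamma_tail k b x]. *)
transitivity (\int[@lebesgue_measure R]_(x in `]0%R, +oo[)
    ((mY `^ mY / Gamma mY)%:E * \sum_(k <oo)
      (ftr_weight mX KX DX j * ftr_weight mY KY DY k *
       (gamma_term j a x * gamma_tail k b x))%:E)).
  apply: eq_integral => x; rewrite inE/= in_itv/= andbT => x0.
  rewrite (ftr_tail KY0 DY01 sY0 ftrY)// muleCA; congr (_ * _).
  rewrite -nneseriesZl; last first.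
    move=> k _; rewrite lee_fin mulr_ge0 ?ftr_weight_ge0//.
    by rewrite gamma_tail_ge0// ltW.
  by apply: eq_eseriesr => k _; rewrite -EFinM mulrACA.
rewrite ge0_integralZl_EFin ?ftr_norm_ge0//; last 2 first.
- move=> x /=; rewrite in_itv/= andbT => x0.
  by apply: nneseries_ge0 => k _ _; exact: h_ge0.
- apply: ge0_emeasurable_sum => [k x|k _]; last exact: mwh.
  by rewrite /= in_itv/= andbT => x0 _; exact: h_ge0.
rewrite integral_nneseries//; last 2 first.
- by move=> k; exact: mwh.
- by move=> k x; rewrite /= in_itv/= andbT; exact: h_ge0.
congr (_ * _); apply: eq_eseriesr => k _.
under eq_integral do rewrite EFinM.
rewrite ge0_integralZl_EFin//; last 3 first.
- move=> x; rewrite /= in_itv/= andbT => x0.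
  by rewrite lee_fin mulr_ge0 ?gamma_term_ge0 ?gamma_tail_ge0 ?(ltW x0).
- exact: mh.
- by rewrite mulr_ge0 ?ftr_weight_ge0.
by rewrite integral_gamma_term_tail// -EFinM.
Qed.

End ftr_race.

(** * Secrecy capacity and the final formula *)

(** Nonnegative SNRs put [1 + x] and [1 + y] in the range where [ln] is strictly increasing. *)
Lemma secrecy_capacity_gt0 (R : realType) (x y : R) : 0 <= x -> 0 <= y ->
  (0 < secrecy_capacity x y) = (y < x).
Proof.
move=> x0 y0; rewrite /secrecy_capacity lt_max ltxx orbF subr_gt0.
by rewrite ltr_ln ?ltrD2l// posrE ltr_pwDl.
Qed.

Theorem mainTheorem4 (R : realType) (d : measure_display)
    (T : measurableType d) (P : probability T R)
    (gammaD gammaE : {RV P >-> R})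
    (mD KD DeltaD sigmaD mE KE DeltaE sigmaE : R)
    (rho eta : R)
    (hmD : 0 < mD) (hKD : 0 <= KD) (hDeltaD : 0 <= DeltaD <= 1)
    (hsigmaD : 0 < sigmaD ^+ 2)
    (hmE : 0 < mE) (hKE : 0 <= KE) (hDeltaE : 0 <= DeltaE <= 1)
    (hsigmaE : 0 < sigmaE ^+ 2)
    (hD0 : forall w : T, 0 <= gammaD w)
    (hE0 : forall w : T, 0 <= gammaE w)
    (hindep : independent_RVs gammaD gammaE)
    (hD : ftr_fading mD KD DeltaD sigmaD gammaD)
    (hE : ftr_fading mE KE DeltaE sigmaE gammaE)
    (hrho : rho = (sigmaD ^+ 2 * (KD + 1)) / (sigmaE ^+ 2 * (KE + 1)))
    (heta : eta = (KE + 1) / (KD + 1)) :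
  P [set w : T | 0 < secrecy_capacity (gammaD w) (gammaE w)] =
    P [set w : T | gammaE w < gammaD w] /\
  P [set w : T | 0 < secrecy_capacity (gammaD w) (gammaE w)] =
    (1 - ((mD `^ mD * mE `^ mE) / (Gamma mD * Gamma mE))%:E *
       \sum_(jD <oo) \sum_(jE <oo)
         ((KD ^+ jD * ftr_coef mD KD DeltaD jD *
             KE ^+ jE * ftr_coef mE KE DeltaE jE) / (jD`!%:R * jE`!%:R) *
          ((rho * eta) ^+ jE / (1 + rho * eta) ^+ (jD + jE + 1)) *
          \sum_(0 <= k < jE.+1)
             ((1 / (rho * eta)) ^+ k *
              ((jD + jE + 1)`!%:R / ((jD + 1 + k)`!%:R * (jE - k)`!%:R))))%:E)%E.
Proof.
have capacityE : [set w : T | 0 < secrecy_capacity (gammaD w) (gammaE w)] =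
    [set w : T | gammaE w < gammaD w].
  by apply/seteqP; split => w /=; rewrite secrecy_capacity_gt0.
rewrite capacityE; split=> //.
have -> : [set w | gammaE w < gammaD w] = ~` [set w | gammaD w <= gammaE w].
  by apply/seteqP; split => w /=; rewrite ltNge => /negP.
rewrite probability_setC; last first.
  by rewrite -[X in measurable X]setTI; exact: measurable_fun_le.
congr (1 - _)%E.
rewrite (ftr_prob_le hKD hKE hDeltaD hDeltaE hsigmaD hsigmaE hD hE hindep).
rewrite mulrACA -invfM; congr (_ * _)%E.
apply: eq_eseriesr => j _; apply: eq_eseriesr => k _; congr (_%:E).
set a := 2 * sigmaD ^+ 2; set b := 2 * sigmaE ^+ 2.
have a0 : 0 < a by rewrite mulr_gt0.
have b0 : 0 < b by rewrite mulr_gt0.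
(* The factors [KD + 1] and [KE + 1] cancel, as do the factors 2 of the scales. *)
have -> : rho * eta = a / b.
  have KD1 : KD + 1 != 0 by rewrite lt0r_neq0// ltr_wpDl.
  have KE1 : KE + 1 != 0 by rewrite lt0r_neq0// ltr_wpDl.
  have sE0 : sigmaE != 0 by rewrite -sqrf_eq0 lt0r_neq0.
  by rewrite hrho heta /a /b; field; rewrite KD1 KE1 sE0.
rewrite /ftr_weight negative_binomial_tail_odds//.
set S := \sum_(0 <= l < k.+1) _; set A := _ ^+ k / _.
(* One factorial per index in the weights cancels against the j! k! of the integral. *)
by field; rewrite !pnatr_eq0 -!lt0n !fact_gt0.
Qed.
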